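(* Let $\mathbf{p}=(p_i)_{i\ge1}$ with $p_1=0$, $p_2=1$, $p_i\in(0,1)$ for $i\ge 3$, let $q_i=1-p_i$, and let $K_n^{\mathbf{p}}$ be the number of cycles of the random derangement process $X^{n,\mathbf{p}}$. Let $\bar q_n=\sum_{i=1}^nq_i$ and $\bar{\bar q}_n=\sum_{i=1}^nq_i^2$, and suppose $(\bar{\bar q}_n)^2/\bar q_n\to0$ as $n\to\infty$. Then, as $n\to\infty$, $$\frac{K_n^{\mathbf{p}}-\bar q_n}{\sqrt{\bar q_n}}\Rightarrow\mathcal{N},$$ where $\mathcal{N}$ is a standard normal random variable and $\Rightarrow$ denotes convergence in distribution.
   Context: Random derangement process: for $n\ge 2$, $X^{n,\mathbf{p}}=(X_{n+1}=1,X_n,\dots,X_1)$ is the $\{0,1\}$-valued inhomogeneous Markov chain, run in decreasing index and started from $X_{n+1}=1$, such that $X_n=0$ a.s., $X_1=1$ a.s., and for $2\le r\le n-1$: $\mathbb{P}(X_r=0\mid X_{r+1}=0)=p_r$, $\mathbb{P}(X_r=1\mid X_{r+1}=0)=q_r$, $\mathbb{P}(X_r=0\mid X_{r+1}=1)=1$. The number of cycles is $K_n^{\mathbf{p}}=\sum_{i=1}^nX_i$. *)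

(* Defs.v *)
From mathcomp Require Import all_boot all_order all_algebra.
From mathcomp Require Import all_classical all_reals all_analysis.
From mathcomp Require Import measurable_realfun.
Import Order.TTheory GRing.Theory Num.Theory.
Import numFieldNormedType.Exports.

Set Implicit Arguments.
Unset Strict Implicit.
Unset Printing Implicit Defensive.

Local Open Scope classical_set_scope.
Local Open Scope ring_scope.

(* Meaningful only when P B is nonzero; every use below is under that guard. *)
Definition cond_prob (R : realType) (d : measure_display)
    (T : measurableType d) (P : probability T R) (A B : set T) : R :=
  fine (P (A `&` B)) / fine (P B).

Section DerangementProcess.
Context (R : realType) (d : measure_display) (T : measurableType d).
Context (P : probability T R).
Implicit Types (X : nat -> {RV P >-> R}) (x : nat -> R) (n r : nat).

Definition at_value X r (a : R) : set T := [set w | X r w = a].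

(* The trajectory up to and including time r: time runs downwards from n + 1. *)
Definition past X n r x : set T :=
  [set w | forall i, (r <= i <= n.+1)%N -> X i w = x i].

Definition decreasing_markov X n : Prop :=
  forall r x (a : R), (1 <= r <= n)%N -> (0 < P (past X n r.+1 x))%E ->
    cond_prob P (at_value X r a) (past X n r.+1 x) =
    cond_prob P (at_value X r a) (at_value X r.+1 (x r.+1)).

(* X i is relevant only for 1 <= i <= n + 1. The transition laws are required
   only where the conditioning event is not null; for instance
   X n = 1 has probability 0. *)
Record derangement_process (p : nat -> R) n X : Prop := {
  dp_values : forall i w, (1 <= i <= n.+1)%N -> X i w = 0 \/ X i w = 1;
  dp_markov : decreasing_markov X n;
  dp_start : P (at_value X n.+1 1) = 1%E;
  dp_Xn : P (at_value X n 0) = 1%E;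
  dp_X1 : P (at_value X 1 1) = 1%E;
  dp_step00 : forall r, (2 <= r <= n.-1)%N -> (0 < P (at_value X r.+1 0%R))%E ->
    cond_prob P (at_value X r 0) (at_value X r.+1 0) = p r;
  dp_step01 : forall r, (2 <= r <= n.-1)%N ->
    (0 < P (at_value X r.+1 0%R))%E ->
    cond_prob P (at_value X r 1) (at_value X r.+1 0) = 1 - p r;
  dp_step10 : forall r, (2 <= r <= n.-1)%N -> (0 < P (at_value X r.+1 1%R))%E ->
    cond_prob P (at_value X r 0) (at_value X r.+1 1) = 1
}.

Definition num_cycles X n : {RV P >-> R} :=
  \sum_(1 <= i < n.+1) (X i : {mfun T >-> R}).

Definition standardized (K : {RV P >-> R}) (m s : R) : {RV P >-> R} :=
  ((K : {mfun T >-> R}) - cst m) * cst s^-1.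

End DerangementProcess.

Definition sum_q (R : realType) (p : nat -> R) (n : nat) : R :=
  \sum_(1 <= i < n.+1) (1 - p i).

Definition sum_q2 (R : realType) (p : nat -> R) (n : nat) : R :=
  \sum_(1 <= i < n.+1) (1 - p i) ^+ 2.

(* Each term may live on its own probability space. *)
Definition cvg_in_distribution (R : realType) (d : nat -> measure_display)
    (T : forall n, measurableType (d n)) (P : forall n, probability (T n) R)
    (Y : forall n, {RV (P n) >-> R})
    (d' : measure_display) (T' : measurableType d') (P' : probability T' R)
    (Z : {RV P' >-> R}) : Prop :=
  forall x : R, {for x, continuous (cdf Z)} ->
    cdf (Y n) x @[n --> \oo] --> cdf Z x.

Definition standard_normal (R : realType) (d : measure_display)
    (T : measurableType d) (P : probability T R) (Z : {RV P >-> R}) : Prop :=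
  forall A : set R, measurable A -> distribution P Z A = normal_prob 0 1 A.

(* Main.v *)
(* Write D_n g(s) for the mean of g(s + K) over the chain and B_n g(s) for its
   mean over independent Bernoulli(q_i) variables. Both satisfy linear
   recursions in n, and for g with increments at most L they differ by at most
   L (q_1^2 + ... + q_n^2). Independent sums are treated by Lindeberg's method
   with the explicit solution (x, s) |-> Phi ((a - x) / s) of the heat equation:
   adding a centred Bernoulli(q) variable is, up to O(q / s^3), the same as
   replacing s^2 by s^2 + p q. Taking s = e sqrt(lam) with
   lam = q_1 + ... + q_n, all the errors vanish as n grows, and the indicator of
   {k <= lam + x sqrt(lam)} is squeezed between the functions
   Phi ((lam + (x -+ M e) sqrt(lam) - k) / s), up to Phi(- M) and 1 - Phi(M). *)

Require Import Defs.
From mathcomp Require Import all_boot all_order all_algebra.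
From mathcomp Require Import all_classical all_reals all_analysis.
From mathcomp Require Import measurable_realfun.
From mathcomp Require Import zify ring lra.
Import Order.TTheory GRing.Theory Num.Theory.
Import numFieldNormedType.Exports.

Set Implicit Arguments.
Unset Strict Implicit.
Unset Printing Implicit Defensive.

Local Open Scope classical_set_scope.
Local Open Scope ring_scope.

(** * The standard normal distribution function *)

Section StandardNormal.
Context {R : realType}.
Implicit Types x y z c p k t : R.

Let scaleE (a b : R) : a *: b = a * b. Proof. by []. Qed.

Definition gauss_pdf : R -> R := normal_pdf 0 1.

Definition gauss_cdf x : R := fine (normal_prob 0 1 `]-oo, x]).

Lemma gauss_pdfE x : gauss_pdf x = normal_peak 1 * expR (- (x ^+ 2 / 2)).
Proof.
rewrite /gauss_pdf normal_pdfE ?oner_neq0// /normal_fun subr0 expr1n.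
by rewrite mulNr.
Qed.

Lemma normal_peak1_le1 : normal_peak 1 <= 1 :> R.
Proof.
have pi2 : 1 <= pi *+ 2 :> R by have := pi_ge2 R; rewrite mulr2n; lra.
rewrite /normal_peak expr1n mul1r invf_le1 ?sqrtr_gt0 ?(lt_le_trans ltr01)//.
by rewrite -[leLHS]sqrtr1 ler_sqrt// (le_trans ler01).
Qed.

Lemma gauss_pdf_ge0 x : 0 <= gauss_pdf x.
Proof. exact: normal_pdf_ge0. Qed.

(** With [e = exp (- x^2 / 4)] the density is at most [e^2], and [x^2 e <= 4] follows from
    [1 + u <= exp u]; hence 17 = 1 + 4^2. *)
Lemma gauss_pdf_moment4 x : (1 + x ^+ 4) * gauss_pdf x <= 17.
Proof.
have e0 := expR_gt0 (- (x ^+ 2 / 4)).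
have e1 := expR_ge1Dx (x ^+ 2 / 4).
have h : x ^+ 2 * expR (- (x ^+ 2 / 4)) <= 4.
  rewrite expRN ler_pdivrMr ?expR_gt0//; lra.
have h1 : expR (- (x ^+ 2 / 4)) <= 1.
  by rewrite -[leRHS]expR0 ler_expR; have := sqr_ge0 x; lra.
have -> : gauss_pdf x = normal_peak 1 * expR (- (x ^+ 2 / 4)) ^+ 2.
  rewrite gauss_pdfE [expR _ ^+ 2]expr2 -expRD; congr (_ * expR _); lra.
have k0 := normal_peak_ge0 (1 : R); have k1 := normal_peak1_le1.
set e := expR _ in e0 h h1 *.
have h2 : (x ^+ 2 * e) ^+ 2 <= 16.
  have -> : 16 = 4 ^+ 2 :> R by ring.
  by rewrite lerXn2r ?nnegrE// mulr_ge0 ?sqr_ge0 ?(ltW e0).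
have h3 : e ^+ 2 <= 1 by rewrite expr_le1// ltW.
have -> : (1 + x ^+ 4) * (normal_peak 1 * e ^+ 2) =
  normal_peak 1 * (e ^+ 2 + (x ^+ 2 * e) ^+ 2) by ring.
have h4 : 0 <= e ^+ 2 + (x ^+ 2 * e) ^+ 2 by rewrite addr_ge0 ?sqr_ge0.
nra.
Qed.

Lemma gauss_pdf_le17 x : gauss_pdf x <= 17.
Proof.
apply: le_trans (gauss_pdf_moment4 x).
rewrite ler_peMl ?gauss_pdf_ge0//.
by have := sqr_ge0 (x ^+ 2); rewrite -exprM; lra.
Qed.

Lemma is_derive_gauss_cdf x : is_derive x 1 gauss_cdf (gauss_pdf x).
Proof.
(* The upper limit [x + 1] makes [x] an interior point of the interval. *)
have intN : lebesgue_measure.-integrable `]-oo, (x + 1)] (EFin \o gauss_pdf).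
  apply: (integrableS measurableT) => //.
  exact: integrable_normal_pdf.
have [|||dF F'] := @continuous_FTC1 R gauss_pdf -oo%O x (x + 1) _ intN.
- by rewrite ltrDl.
- by rewrite ltNyr.
- by apply: continuous_normal_pdf; exact: oner_neq0.
by apply: DeriveDef => //; rewrite -derive1E.
Qed.

Lemma is_derive_gauss_pdf x : is_derive x 1 gauss_pdf (- (x * gauss_pdf x)).
Proof.
have -> : gauss_pdf = normal_peak 1 \*: (expR \o (fun x => - (2^-1 * x ^+ 2))).
  apply/funext => y; rewrite gauss_pdfE /= [2^-1 * _]mulrC.
  by [].
apply: is_derive_eq.
by rewrite /= !scaleE; field.
Qed.

Lemma MVT_between (f df : R -> R) x y :
  (forall z, is_derive z 1 f (df z)) ->
  exists2 c, Num.min x y <= c <= Num.max x y & f y - f x = df c * (y - x).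
Proof.
move=> fdf.
have fc a b : {within `[a, b], continuous f}.
  by apply: derivable_within_continuous => z _; exact: ex_derive.
have [xy|/ltW yx] := leP x y.
  have [c] := MVT_segment xy (fun z _ => fdf z) (fc x y).
  by rewrite in_itv/=; exists c.
have [c] := MVT_segment yx (fun z _ => fdf z) (fc y x).
rewrite in_itv/= => cyx e; exists c => //.
by rewrite -[RHS]opprK -mulrN opprB -e opprB.
Qed.

Lemma derive_bound_lipschitz (f df : R -> R) C x y :
  (forall z, is_derive z 1 f (df z)) -> (forall z, `|df z| <= C) ->
  `|f y - f x| <= C * `|y - x|.
Proof.
move=> fdf dfC; have [c _ ->] := MVT_between x y fdf.
by rewrite normrM ler_wpM2r.
Qed.

Lemma gauss_cdf_lipschitz x y :
  `|gauss_cdf y - gauss_cdf x| <= 17 * `|y - x|.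
Proof.
apply: (derive_bound_lipschitz x y is_derive_gauss_cdf) => z.
by rewrite ger0_norm ?gauss_pdf_ge0// gauss_pdf_le17.
Qed.

(** Up to sign, the derivative of [gauss_pdf]. *)
Let psi x := x * gauss_pdf x.

Let is_derive_psi x : is_derive x 1 psi ((1 - x ^+ 2) * gauss_pdf x).
Proof.
have d := is_derive_gauss_pdf x.
apply: is_derive_eq.
by rewrite /= !scaleE; ring.
Qed.

Let poly_gauss_le x a : `|a| <= 2 * (1 + x ^+ 4) -> `|a * gauss_pdf x| <= 34.
Proof.
move=> ha; rewrite normrM (ger0_norm (gauss_pdf_ge0 _)).
have := gauss_pdf_moment4 x; have := gauss_pdf_ge0 x; nra.
Qed.

Let psi_le x : `|psi x| <= 34.
Proof.
apply: poly_gauss_le; have := sqr_ge0 (x ^+ 2); rewrite -exprM.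
have := sqr_ge0 (x ^+ 2 - 1); have := sqr_ge0 (x + 1).
by have := sqr_ge0 (x - 1); rewrite ler_norml; nra.
Qed.

Let psi_lipschitz x y : `|psi y - psi x| <= 34 * `|y - x|.
Proof.
apply: (derive_bound_lipschitz x y is_derive_psi) => z.
apply: poly_gauss_le; have := sqr_ge0 (z ^+ 2 - 1).
by have := sqr_ge0 z; rewrite ler_norml; nra.
Qed.

(** A Lipschitz bound on [psi] would cost a factor [|z|]. Instead, [t] times the derivative of
    [psi (z t)] in [t] depends on [z t] alone and is bounded by 34; then [t >= k] is used. *)
Let psi_scale z k : 0 < k <= 1 -> `|psi z - psi (z * k)| <= 34 / k * (1 - k).
Proof.
move=> /andP[k0 k1].
pose f := psi \o (fun t => z * t).
pose df t := (1 - (z * t) ^+ 2) * gauss_pdf (z * t) * z.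
have fdf t : is_derive t 1 f (df t).
  have d := is_derive_psi (z * t).
  apply: is_derive_eq.
  by rewrite /= !scaleE /df; ring.
have [c] := MVT_between k 1 fdf.
rewrite min_l// max_r// => /andP[kc c1].
rewrite /f /= mulr1 => ->; rewrite normrM [`|1 - k|]ger0_norm ?subr_ge0//.
rewrite ler_wpM2r ?subr_ge0// ler_pdivlMr//.
have c0 := lt_le_trans k0 kc.
have h : `|df c| * c <= 34.
  have -> : `|df c| * c = `|df c * c| by rewrite [RHS]normrM (gtr0_norm c0).
  have -> : df c * c = ((z * c) - (z * c) ^+ 3) * gauss_pdf (z * c).
    by rewrite /df; ring.
  set x := z * c; apply: poly_gauss_le.
  have := sqr_ge0 (x ^+ 2 - 1); have := sqr_ge0 (x + 1).
  have := sqr_ge0 (x ^+ 2 - x); have := sqr_ge0 (x ^+ 2 + x).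
  by have := sqr_ge0 (x - 1); rewrite ler_norml; nra.
by apply: le_trans h; rewrite ler_wpM2l.
Qed.

(** This factor rescales the argument of [gauss_cdf] when the variance grows from 1 to
    [1 + c y^2]. *)
Let is_derive_shrink c y : 0 <= c ->
  is_derive y 1 (fun y => (Num.sqrt (1 + c * y ^+ 2))^-1)
    (- (c * y * (Num.sqrt (1 + c * y ^+ 2))^-1 ^+ 3)).
Proof.
move=> c0.
have r0 : 0 < 1 + c * y ^+ 2 by rewrite ltr_pwDl// mulr_ge0 ?sqr_ge0.
have d1 : is_derive y 1 (fun y => 1 + c * y ^+ 2) (2 * c * y).
  apply: is_derive_eq.
  by rewrite /= !scaleE; ring.
have d2 := @is_derive1_comp _ Num.sqrt (fun y => 1 + c * y ^+ 2) _ _ _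
  (is_derive1_sqrt r0) d1.
have s0 : 0 < Num.sqrt (1 + c * y ^+ 2) by rewrite sqrtr_gt0.
have d3 := @is_deriveV _ (Num.sqrt \o (fun y => 1 + c * y ^+ 2)) _ _ _
  (lt0r_neq0 s0) d2.
apply: (is_derive_eq d3).
by rewrite /= scaleE; field; rewrite gt_eqF.
Qed.

(* Differentiating the left-hand side in [y] leaves
   [p q y (k^2 psi (z k) - psi xi)] with [k = (1 + p q y^2)^-1/2],
   [psi x = x gauss_pdf x] and [|xi - z| <= y]. *)
Lemma bernoulli_smoothing p z y : 0 <= p <= 1 -> 0 <= y <= 1 ->
  `|p * gauss_cdf (z + (1 - p) * y) + (1 - p) * gauss_cdf (z - p * y)
    - gauss_cdf (z / Num.sqrt (1 + p * (1 - p) * y ^+ 2))|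
  <= 102 * (p * (1 - p)) * y ^+ 3.
Proof.
move=> /andP[p0 p1] /andP[y0 y1].
have q0 : 0 <= 1 - p by rewrite subr_ge0.
pose c := p * (1 - p).
have c0 : 0 <= c by rewrite mulr_ge0.
have c1 : c <= 1 by rewrite /c; nra.
pose k y := (Num.sqrt (1 + c * y ^+ 2))^-1.
pose G y := p * gauss_cdf (z + (1 - p) * y) + (1 - p) * gauss_cdf (z - p * y)
    - gauss_cdf (z * k y).
pose dG y := c * (gauss_pdf (z + (1 - p) * y) - gauss_pdf (z - p * y)
   + y * k y ^+ 2 * psi (z * k y)).
have GdG t : is_derive t 1 G (dG t).
  have d1 : is_derive t 1 (gauss_cdf \o (fun t => z + (1 - p) * t))
      (gauss_pdf (z + (1 - p) * t) * (1 - p)).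
    have d := is_derive_gauss_cdf (z + (1 - p) * t).
    apply: is_derive1_comp; apply: is_derive_eq.
    by rewrite /= !scaleE; ring.
  have d2 : is_derive t 1 (gauss_cdf \o (fun t => z - p * t))
      (gauss_pdf (z - p * t) * (- p)).
    have d := is_derive_gauss_cdf (z - p * t).
    apply: is_derive1_comp; apply: is_derive_eq.
    by rewrite /= !scaleE; ring.
  have d3 : is_derive t 1 (gauss_cdf \o (fun t => z * k t))
      (gauss_pdf (z * k t) * (z * - (c * t * k t ^+ 3))).
    have d := is_derive_gauss_cdf (z * k t).
    apply: is_derive1_comp.
    have dk := is_derive_shrink t c0.
    have -> : (fun t => z * k t) = z \*: k by [].
    exact: is_deriveZ.
  have -> : G = (p \*: (gauss_cdf \o (fun t => z + (1 - p) * t)) +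
     (1 - p) \*: (gauss_cdf \o (fun t => z - p * t)))
     - (gauss_cdf \o (fun t => z * k t)) by [].
  apply: is_derive_eq.
  by rewrite !scaleE /dG /psi /c; ring.
(* Since [G 0 = 0], a bound of order [t^2] on the derivative yields the cubic bound. *)
have [|t] := @MVT_segment _ G dG 0 y y0 (fun t _ => GdG t).
  by apply: derivable_within_continuous => t _; exact: ex_derive.
rewrite in_itv/= => /andP[t0 ty].
have -> : G 0 = 0.
  rewrite /G /k expr0n/= !mulr0 addr0 subr0 addr0 sqrtr1 invr1 mulr1; ring.
rewrite !subr0 -/c -/(k y) -/(G y) => ->.
rewrite normrM (ger0_norm y0).
suff H : `|dG t| <= 102 * c * t ^+ 2.
  have -> : 102 * c * y ^+ 3 = 102 * c * y ^+ 2 * y by ring.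
  rewrite ler_wpM2r// (le_trans H)// ler_wpM2l ?mulr_ge0//.
  by rewrite lerXn2r// nnegrE// (le_trans t0).
have t1 := le_trans ty y1.
have r1 : 1 <= 1 + c * t ^+ 2 by rewrite lerDl mulr_ge0 ?sqr_ge0.
have k0 : 0 < k t by rewrite invr_gt0 sqrtr_gt0 (lt_le_trans ltr01).
have k2 : k t ^+ 2 * (1 + c * t ^+ 2) = 1.
  rewrite /k exprVn sqr_sqrtr ?(le_trans ler01)// mulVf//.
  by rewrite gt_eqF// (lt_le_trans ltr01).
have k1 : k t <= 1 by have := mulr_ge0 c0 (sqr_ge0 t); nra.
have [xi] := MVT_between (z - p * t) (z + (1 - p) * t) is_derive_gauss_pdf.
have pt0 := mulr_ge0 p0 t0; have qt0 := mulr_ge0 q0 t0.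
rewrite min_l ?max_r; [|lra|lra].
move=> /andP[xi1 xi2] xiE.
have -> : dG t = c * t * (k t ^+ 2 * psi (z * k t) - psi xi).
  by rewrite /dG xiE /psi; ring.
have zxi : `|z - xi| <= t by rewrite ler_norml; nra.
have kk : k t ^+ 2 <= 1 by rewrite expr_le1// ltW.
have ct : c * t ^+ 2 <= t.
  by apply: (@le_trans _ _ (1 * t ^+ 2)); [rewrite ler_wpM2r ?sqr_ge0|nra].
(* By [k2] the left-hand side is [1 - k t ^+ 2], so [k t] is within [t] of 1. *)
have kct : k t ^+ 2 * (c * t ^+ 2) <= 1 * t.
  by apply: ler_pM; rewrite ?sqr_ge0// mulr_ge0 ?sqr_ge0.
have h1 : k t ^+ 2 * `|psi z - psi (z * k t)| <= 34 * t.
  have := @psi_scale z (k t); rewrite k0 k1 => /(_ isT) h.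
  apply: (@le_trans _ _ (k t ^+ 2 * (34 / k t * (1 - k t)))).
    by rewrite ler_wpM2l ?sqr_ge0.
  have -> : k t ^+ 2 * (34 / k t * (1 - k t)) = 34 * (k t * (1 - k t)).
    by field; rewrite gt_eqF.
  rewrite ler_pM2l//.
  nra.
have h2 : k t ^+ 2 * `|psi xi - psi z| <= 34 * t.
  rewrite -[leRHS]mul1r; apply: ler_pM => //; first exact: sqr_ge0.
  by apply: (le_trans (psi_lipschitz _ _)); rewrite distrC; lra.
have h3 : (1 - k t ^+ 2) * `|psi xi| <= 34 * t.
  rewrite mulrC; apply: ler_pM => //; rewrite ?subr_ge0//.
  nra.
have ct0 : 0 <= c * t by rewrite mulr_ge0.
rewrite normrM (ger0_norm ct0).
have -> : 102 * c * t ^+ 2 = c * t * (102 * t) by ring.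
rewrite ler_wpM2l//.
(* Three errors of at most [34 t] each, whence 102: rescaling [z], moving from [z] to [xi], and
   dropping the factor [k^2]. *)
have -> : k t ^+ 2 * psi (z * k t) - psi xi =
  - (k t ^+ 2 * (psi z - psi (z * k t))) - k t ^+ 2 * (psi xi - psi z)
  - (1 - k t ^+ 2) * psi xi by ring.
apply: (le_trans (ler_normB _ _)).
apply: (le_trans (lerD (ler_normB _ _) (lexx _))).
have kk0 := sqr_ge0 (k t).
have kk1 : 0 <= 1 - k t ^+ 2 by rewrite subr_ge0 expr_le1// ltW.
rewrite normrN !(normrM (k t ^+ 2)) (normrM (1 - _)).
by rewrite (ger0_norm kk0) (ger0_norm kk1); lra.
Qed.

End StandardNormal.

(** * Averages over the chain and over independent Bernoulli variables *)

Section Averages.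
Context {R : realType} (p : nat -> R).
Implicit Types (f g : R -> R) (s L : R) (n : nat).

(* Started at [X_(n+1) = 0], the partial count [X_n + ... + X_1] satisfies
   [E g (s + X_n + ... + X_1) = derangement_avg g n s], a cycle at [r] forcing
   no cycle at [r - 1]; the value at [r = 1] is right because [p 1 = 0]. *)
Fixpoint derangement_avg g n : R -> R :=
  if n is n'.+1 then fun s => p n'.+1 * derangement_avg g n' s
    + (1 - p n'.+1) * derangement_avg g n'.-1 (s + 1)
  else g.

Fixpoint bernoulli_avg g n : R -> R :=
  if n is n'.+1 then fun s => p n'.+1 * bernoulli_avg g n' s
    + (1 - p n'.+1) * bernoulli_avg g n' (s + 1)
  else g.

Hypothesis p01 : forall i, (0 < i)%N -> 0 <= p i <= 1.

Lemma sum_qS n : sum_q p n.+1 = sum_q p n + (1 - p n.+1).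
Proof. by rewrite /sum_q big_nat_recr. Qed.

Lemma sum_q2S n : sum_q2 p n.+1 = sum_q2 p n + (1 - p n.+1) ^+ 2.
Proof. by rewrite /sum_q2 big_nat_recr. Qed.

Lemma sum_q2_ge0 n : 0 <= sum_q2 p n.
Proof. by apply: sumr_ge0 => i _; exact: sqr_ge0. Qed.

(** The difference is the sum of the [p i (1 - p i)], the variance of the Bernoulli sum. *)
Lemma sum_q2_le n : sum_q2 p n <= sum_q p n.
Proof.
elim: n => [|n IH]; first by rewrite /sum_q /sum_q2 !big_geq.
by rewrite sum_qS sum_q2S lerD//; have := p01 (ltn0Sn n); nra.
Qed.

Lemma derangement_avg_le f g n s : (forall s, f s <= g s) ->
  derangement_avg f n s <= derangement_avg g n s.
Proof.
(* The recursion reaches back two indices, so the induction carries [n] and [n.-1] together. *)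
move=> fg; suff : (forall s, derangement_avg f n s <= derangement_avg g n s) /\
    (forall s, derangement_avg f n.-1 s <= derangement_avg g n.-1 s) by case.
elim: n {s} => [|n [IH1 IH2]]; first by [].
split => // s; have /andP[p0 p1] := p01 (ltn0Sn n).
by rewrite /= lerD// ler_wpM2l ?subr_ge0.
Qed.

Lemma derangement_avg_addc f c n s :
  derangement_avg (fun s => f s + c) n s = derangement_avg f n s + c.
Proof.
suff : (forall s, derangement_avg (fun s => f s + c) n s =
         derangement_avg f n s + c) /\
       (forall s, derangement_avg (fun s => f s + c) n.-1 s =
         derangement_avg f n.-1 s + c) by case.
elim: n {s} => [|n [IH1 IH2]]; first by [].
by split => // s; rewrite /= IH1 IH2; ring.
Qed.

(** * Comparison of the chain average with the Bernoulli average *)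

Section Coupling.
Variables (g : R -> R) (L : R).
Hypothesis gL : forall s, `|g (s + 1) - g s| <= L.

Let L_ge0 : 0 <= L. Proof. exact: le_trans (gL 0). Qed.

Let convex_bound q a b : 0 <= q <= 1 -> `|a| <= L -> `|b| <= L ->
  `|q * a + (1 - q) * b| <= L.
Proof. by move=> /andP[q0 q1]; rewrite !ler_norml; nra. Qed.

(** Each increment at [n.+1] is a convex combination of increments at [n]. The third bound calls on
    the fourth and conversely, so all are proved at once. *)
Let derangement_avg_shift n :
  [/\ forall s, `|derangement_avg g n (s + 1) - derangement_avg g n s| <= L,
      forall s, `|derangement_avg g n.-1 (s + 1) - derangement_avg g n.-1 s| <= L,
      forall s, `|derangement_avg g n.-1 (s + 1) - derangement_avg g n s| <= L &
      forall s, `|derangement_avg g n s - derangement_avg g n.-1 s| <= L].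
Proof.
elim: n => [|n [H1 H2 H3 H4]].
  by split => //= s; rewrite subrr normr0.
have pn := p01 (ltn0Sn n); have [p0 p1] := andP pn.
have q0 : 0 <= 1 - p n.+1 by rewrite subr_ge0.
split => // s /=.
- set q := p n.+1 in pn *.
  rewrite [X in `|X|](_ : _ =
    q * (derangement_avg g n (s + 1) - derangement_avg g n s) + (1 - q) *
    (derangement_avg g n.-1 (s + 1 + 1) - derangement_avg g n.-1 (s + 1))).
    exact: convex_bound.
  ring.
- set q := p n.+1 in pn *.
  rewrite [X in `|X|](_ : _ =
    q * (derangement_avg g n (s + 1) - derangement_avg g n s) + (1 - q) *
    (derangement_avg g n (s + 1) - derangement_avg g n.-1 (s + 1))).
    exact: convex_bound.
  ring.
- set q := p n.+1 in pn *.
  rewrite [X in `|X|](_ : _ = q * 0 + (1 - q) *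
    (derangement_avg g n.-1 (s + 1) - derangement_avg g n s)).
    by apply: convex_bound; rewrite ?normr0.
  ring.
Qed.

Lemma derangement_avg_stepS n s :
  `|derangement_avg g n.+1 s - derangement_avg g n s| <= L.
Proof. by have [_ _ _ ->] := derangement_avg_shift n.+1. Qed.

(** The averages at [n] and [n.-1] differ only through the branch with a cycle at [n], which has
    weight [1 - p n]. *)
Let derangement_avg_step n s : (0 < n)%N ->
  `|derangement_avg g n s - derangement_avg g n.-1 s| <= (1 - p n) * L.
Proof.
case: n => // n _ /=; have /andP[p0 p1] := p01 (ltn0Sn n).
have [_ _ /(_ s) H _] := derangement_avg_shift n.
rewrite [X in `|X|](_ : _ = (1 - p n.+1) *
    (derangement_avg g n.-1 (s + 1) - derangement_avg g n s)); last by ring.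
by rewrite normrM ger0_norm ?subr_ge0// ler_wpM2l ?subr_ge0.
Qed.

(* One step of the two averages differs by
   [q_(n+1) * (derangement_avg n - derangement_avg (n-1))], of order
   [q_n q_(n+1) <= (q_n^2 + q_(n+1)^2) / 2]. *)
Lemma derangement_bernoulli_avg n s :
  `|derangement_avg g n s - bernoulli_avg g n s| <= sum_q2 p n * L.
Proof.
case: n => [|n]; first by rewrite /= subrr normr0 mulr_ge0 ?sum_q2_ge0.
(* The bound is sharpened for the induction: the half square withheld here absorbs the [q_n^2 / 2]
   that the next step produces. *)
apply: (@le_trans _ _ ((sum_q2 p n.+1 - (1 - p n.+1) ^+ 2 / 2) * L)); last first.
  by rewrite ler_wpM2r// gerBl divr_ge0 ?sqr_ge0.
elim: n s => [|n IH] s.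
  rewrite /= subrr normr0 mulr_ge0//= sum_q2S addrAC /sum_q2 big_geq//.
  by have := sqr_ge0 (1 - p 1%N); lra.
have /andP[p0 p1] := p01 (ltn0Sn n.+1).
have /andP[p0' p1'] := p01 (ltn0Sn n).
have := IH s; have := IH (s + 1); have := @derangement_avg_step n.+1 (s + 1) isT.
rewrite (sum_q2S n.+1).
have -> : derangement_avg g n.+2 s = p n.+2 * derangement_avg g n.+1 s
  + (1 - p n.+2) * derangement_avg g n (s + 1) by [].
have -> : bernoulli_avg g n.+2 s = p n.+2 * bernoulli_avg g n.+1 s
  + (1 - p n.+2) * bernoulli_avg g n.+1 (s + 1) by [].
rewrite [n.+1.-1]/=.
move: (derangement_avg g n.+1 s) (derangement_avg g n.+1 (s + 1)).
move: (derangement_avg g n (s + 1)).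
move: (bernoulli_avg g n.+1 s) (bernoulli_avg g n.+1 (s + 1)).
move: (sum_q2 p n.+1) (p n.+1) (p n.+2) p0 p1 p0' p1'.
move=> V q' q q0 q1 q0' q1' b b1 d0 d d1 h1 h2 h3.
rewrite [X in `|X|](_ : _ = (q * (d - b) + (1 - q) * (d1 - b1))
  - (1 - q) * (d1 - d0)); last by ring.
set e := (V - (1 - q') ^+ 2 / 2) * L in h2 h3.
have h4 : `|q * (d - b) + (1 - q) * (d1 - b1)| <= e.
  by move: h2 h3; rewrite !ler_norml; nra.
have h5 : `|(1 - q) * (d1 - d0)| <= (1 - q) * ((1 - q') * L).
  by rewrite normrM ger0_norm ?subr_ge0// ler_wpM2l ?subr_ge0.
apply: (le_trans (ler_normB _ _)); apply: (le_trans (lerD h4 h5)).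
rewrite /e mulrA -mulrDl ler_wpM2r//.
by have := sqr_ge0 ((1 - q) - (1 - q')); lra.
Qed.

End Coupling.

(** Lindeberg replacement, one variable at a time: with accumulated variance [S^2], the next
    variable is treated by [bernoulli_smoothing] at [y = 1 / S]. Here [1 <= s <= S] ensures [y <= 1]
    and bounds each error by [102 (1 - p i) / s^3]. *)
Lemma bernoulli_avg_normal (a x s : R) n : 1 <= s ->
  `|bernoulli_avg (fun k => gauss_cdf ((a - k) / s)) n x
    - gauss_cdf ((a - x - sum_q p n) /
        Num.sqrt (s ^+ 2 + (sum_q p n - sum_q2 p n)))|
  <= 102 * sum_q p n / s ^+ 3.
Proof.
move=> s1; have s0 : 0 < s by rewrite (lt_le_trans ltr01).
elim: n x => [|n IH] x.
  rewrite /= /sum_q /sum_q2 !big_geq// !subr0 addr0 sqrtr_sqr (gtr0_norm s0).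
  by rewrite subrr normr0 mulr0 mul0r.
have pn := p01 (ltn0Sn n); have /andP[p0 p1] := pn.
have v0 : 0 <= sum_q p n - sum_q2 p n by rewrite subr_ge0 sum_q2_le.
have := IH x; have := IH (x + 1); rewrite sum_qS sum_q2S /=.
set lam := sum_q p n; set S := Num.sqrt (s ^+ 2 + _).
have S2 : S ^+ 2 = s ^+ 2 + (lam - sum_q2 p n).
  by rewrite sqr_sqrtr// addr_ge0 ?sqr_ge0.
have sS : s <= S.
  by rewrite -[s]gtr0_norm// -sqrtr_sqr ler_sqrt ?lerDl// addr_ge0 ?sqr_ge0.
have S0 : 0 < S by rewrite (lt_le_trans s0).
set q := p n.+1 in pn p0 p1 *.
have iS : 0 <= S^-1 <= 1.
  by rewrite invr_ge0 ltW//= invf_le1// (le_trans s1).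
(* Here [q] is [p n.+1]. Subtracting the mean [1 - q] of the new variable makes the two shifted
   arguments those of the induction hypothesis at [x] and [x + 1]. *)
pose z := (a - x - (lam + (1 - q))) / S.
have := bernoulli_smoothing z pn iS.
have -> : z + (1 - q) * S^-1 = (a - x - lam) / S by rewrite /z; field; lra.
have -> : z - q * S^-1 = (a - (x + 1) - lam) / S by rewrite /z; field; lra.
have -> : z / Num.sqrt (1 + q * (1 - q) * S^-1 ^+ 2) = (a - x - (lam + (1 - q))) /
    Num.sqrt (s ^+ 2 + (lam + (1 - q) - (sum_q2 p n + (1 - q) ^+ 2))).
  rewrite /z -mulrA -invfM; congr (_ / _).
  rewrite -{1}[S]gtr0_norm// -sqrtr_sqr -sqrtrM ?sqr_ge0//; congr Num.sqrt.
  have -> : S ^+ 2 * (1 + q * (1 - q) * S^-1 ^+ 2) = S ^+ 2 + q * (1 - q).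
    by field; rewrite gt_eqF.
  by rewrite S2; ring.
set A := gauss_cdf _; set B := gauss_cdf _; set C := gauss_cdf _.
set b1 := bernoulli_avg _ _ _; set b2 := bernoulli_avg _ _ _.
move=> h1 h2 h3.
have h4 : 102 * (q * (1 - q)) * S^-1 ^+ 3 <= 102 * (1 - q) / s ^+ 3.
  rewrite exprVn; apply: ler_pM.
  - by rewrite !mulr_ge0 ?subr_ge0.
  - by rewrite invr_ge0 exprn_ge0// ltW.
  - nra.
  - by rewrite lef_pV2 ?posrE ?exprn_gt0// lerXn2r// nnegrE ltW.
have -> : 102 * (lam + (1 - q)) / s ^+ 3 =
  102 * lam / s ^+ 3 + 102 * (1 - q) / s ^+ 3 by ring.
move: h1 h2 h3 h4.
move: (102 * lam / s ^+ 3) (102 * (1 - q) / s ^+ 3) (102 * (q * (1 - q)) / S ^+ 3).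
move=> e1 e2 e3; rewrite !ler_norml; nra.
Qed.

End Averages.

(** * Normal approximation *)

Section NormalApproximation.
Context {R : realType}.
Implicit Types (x M e t : R).

Lemma gauss_cdf_ge0 x : 0 <= gauss_cdf x.
Proof. exact/fine_ge0/measure_ge0. Qed.

Lemma gauss_cdf_le1 x : gauss_cdf x <= 1.
Proof.
by rewrite -[leRHS]/(fine 1%:E) fine_le ?fin_num_measure// probability_le1.
Qed.

Lemma gauss_cdf_nondecreasing x y : x <= y -> gauss_cdf x <= gauss_cdf y.
Proof.
move=> xy; rewrite fine_le ?fin_num_measure// le_measure ?inE//.
by apply: subset_itvl; rewrite bnd_simp.
Qed.

Let sqrt_shrink (h e : R) : 0 < e <= 2^-1 -> `|h| <= e ->
  `|(Num.sqrt (1 + h))^-1 - 1| <= 2 * e.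
Proof.
move=> /andP[e0 e1]; rewrite ler_norml => /andP[h0 h1].
set w := Num.sqrt (1 + h).
have w2 : w ^+ 2 = 1 + h by rewrite sqr_sqrtr//; lra.
have w12 : 2^-1 <= w.
  have : 0 <= w by exact: sqrtr_ge0.
  nra.
have w0 : 0 < w by lra.
have -> : w^-1 - 1 = (1 - w) / w by field; rewrite gt_eqF.
by rewrite ler_norml ler_pdivlMr// ler_pdivrMr//; nra.
Qed.

(* [u] stands for the relative variance deficit [sum_q2 p n / sum_q p n] of the
   Bernoulli sum. *)
Let gauss_cdf_perturb x m e u : 0 < e <= 2^-1 -> 0 <= u <= e ->
  `|gauss_cdf ((x + m * e) / Num.sqrt (e ^+ 2 + (1 - u))) - gauss_cdf x|
  <= 17 * ((2 * `|x| + 3 * `|m|) * e).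
Proof.
move=> e01 /andP[u0 ue]; have /andP[e0 e1] := e01.
apply: (le_trans (gauss_cdf_lipschitz _ _)); rewrite ler_pM2l//.
have -> : e ^+ 2 + (1 - u) = 1 + (e ^+ 2 - u) by ring.
have h : `|e ^+ 2 - u| <= e by rewrite ler_norml; nra.
have := sqrt_shrink e01 h; set w := _^-1 => hw.
have -> : (x + m * e) * w - x = x * (w - 1) + m * (e * (w - 1)) + m * e by ring.
apply: (le_trans (ler_normD _ _)).
apply: (le_trans (lerD (ler_normD _ _) (lexx _))).
rewrite !normrM (gtr0_norm e0).
have := normr_ge0 x; have := normr_ge0 m; have := normr_ge0 (w - 1).
move: `|x| `|m| `|w - 1| hw => X Y W hW W0 Y0 X0.
have : X * W <= X * (2 * e) by rewrite ler_wpM2l.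
have : Y * (e * W) <= Y * e.
  by rewrite ler_wpM2l// ler_piMr ?(ltW e0)//; lra.
nra.
Qed.

Variable p : nat -> R.
Hypothesis p01 : forall i, (0 < i)%N -> 0 <= p i <= 1.

Local Notation lam := (sum_q p).
Local Notation V := (sum_q2 p).

(** Four errors add up: passing from [n.-1] to [n], from the chain to Bernoulli variables, from
    these to [gauss_cdf], and perturbing its argument. As [1 <= V n <= t S] with [S = sqrt (lam n)],
    both [1 / S] and [V n / S] are at most [t], which controls the first three. *)
Lemma derangement_avg_smooth x m e t n : 0 < e <= 2^-1 -> 0 < t <= e ->
  1 <= V n <= t * Num.sqrt (lam n) ->
  `|derangement_avg p
      (fun k => gauss_cdf ((lam n + (x + m * e) * Num.sqrt (lam n) - k)
                           / (e * Num.sqrt (lam n)))) n.-1 0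
    - gauss_cdf x| <=
  17 * ((2 * `|x| + 3 * `|m|) * e) + (34 / e + 102 / e ^+ 3) * t.
Proof.
move=> e01 /andP[t0 te] /andP[V1 Vt]; have /andP[e0 e1] := e01.
set S := Num.sqrt (lam n) in Vt *.
have S0 : 0 < S by rewrite -(pmulr_rgt0 _ t0); apply: lt_le_trans Vt; lra.
have l0 : 0 < lam n by rewrite -sqrtr_gt0.
have S2 : lam n = S ^+ 2 by rewrite sqr_sqrtr// ltW.
have n0 : (0 < n)%N.
  by case: (n) V1 => //; rewrite /sum_q2 big_geq// ler10.
have s1 : 1 <= e * S by apply: (le_trans V1); apply: (le_trans Vt); rewrite ler_pM2r.
have s0 : 0 < e * S by rewrite mulr_gt0.
set a := lam n + _; set g := fun k => _.
have gL k : `|g (k + 1) - g k| <= 17 / (e * S).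
  apply: (le_trans (gauss_cdf_lipschitz _ _)); rewrite ler_pM2l//.
  rewrite -mulrBl (_ : _ - _ = -1); last by ring.
  by rewrite mulN1r normrN gtr0_norm// invr_gt0.
have h1 : `|derangement_avg p g n 0 - derangement_avg p g n.-1 0| <= 17 / (e * S).
  rewrite -{1}(prednK n0); exact: derangement_avg_stepS.
have h2 := derangement_bernoulli_avg p01 gL n 0.
have h3 := bernoulli_avg_normal p01 a 0 n s1.
have h4 : `|gauss_cdf ((a - 0 - lam n) /
   Num.sqrt ((e * S) ^+ 2 + (lam n - V n))) - gauss_cdf x|
   <= 17 * ((2 * `|x| + 3 * `|m|) * e).
  have -> : (a - 0 - lam n) / Num.sqrt ((e * S) ^+ 2 + (lam n - V n)) =
     (x + m * e) / Num.sqrt (e ^+ 2 + (1 - V n / lam n)).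
    have -> : (e * S) ^+ 2 + (lam n - V n) =
        lam n * (e ^+ 2 + (1 - V n / lam n)).
      by rewrite exprMn -S2; field; rewrite gt_eqF.
    rewrite sqrtrM ?(ltW l0)// -/S /a subr0 [lam n + _]addrC addrK.
    by rewrite invfM mulrA mulfK// gt_eqF.
  apply: gauss_cdf_perturb => //; rewrite divr_ge0 ?(ltW l0) ?(le_trans ler01)//=.
  rewrite ler_pdivrMr// S2; nra.
have iS : S^-1 <= t.
  by rewrite -[_^-1]mul1r ler_pdivrMr//; lra.
have VS : V n / S <= t by rewrite ler_pdivrMr.
have b1 : 17 / (e * S) <= 17 / e * t.
  by rewrite invfM mulrA ler_pM2l// divr_gt0.
have b2 : V n * (17 / (e * S)) <= 17 / e * t.
  have -> : V n * (17 / (e * S)) = 17 / e * (V n / S) by field; lra.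
  by rewrite ler_pM2l// divr_gt0.
have b3 : 102 * lam n / (e * S) ^+ 3 <= 102 / e ^+ 3 * t.
  have -> : 102 * lam n / (e * S) ^+ 3 = 102 / e ^+ 3 * S^-1.
    by rewrite S2; field; lra.
  by rewrite ler_pM2l// divr_gt0// exprn_gt0.
have -> : (34 / e + 102 / e ^+ 3) * t =
  17 / e * t + 17 / e * t + 102 / e ^+ 3 * t by ring.
move: h1 h2 h3 h4 b1 b2 b3.
move: (17 / e * t) (102 / e ^+ 3 * t) => B1 B2.
rewrite !ler_norml; lra.
Qed.

Lemma derangement_avg_cdf x M e t n : 0 <= M -> 0 < e <= 2^-1 -> 0 < t <= e ->
  1 <= V n <= t * Num.sqrt (lam n) ->
  `|derangement_avg p
      (fun k => \1_[set k | (k - lam n) / Num.sqrt (lam n) <= x] k) n.-1 0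
    - gauss_cdf x| <=
  (1 - gauss_cdf M) + gauss_cdf (- M)
  + (17 * ((2 * `|x| + 3 * M) * e) + (34 / e + 102 / e ^+ 3) * t).
Proof.
move=> M0 e01 te Vt; have /andP[e0 e1] := e01.
have := derangement_avg_smooth x M e01 te Vt.
have := derangement_avg_smooth x (- M) e01 te Vt.
rewrite normrN (ger0_norm M0).
have S0 : 0 < Num.sqrt (lam n).
  have /andP[t0 _] := te; have /andP[V1 V2] := Vt.
  by rewrite -(pmulr_rgt0 _ t0); apply: lt_le_trans V2; lra.
set S := Num.sqrt (lam n) in S0 *.
set g1 := fun k => gauss_cdf _; set g2 := fun k => gauss_cdf _.
set f := fun k => \1__ k.
(* Below the threshold [lam n + x S], the argument of [gauss_cdf] in [g2] is at least [M]. *)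
have up k : f k <= g2 k + (1 - gauss_cdf M).
  rewrite /f indicE; case: (boolP (k \in _)) => [|_].
    rewrite inE /= ler_pdivrMr// => kx; rewrite /g2 addrCA lerDl subr_ge0.
    apply: gauss_cdf_nondecreasing; rewrite ler_pdivlMr ?mulr_gt0//.
    by rewrite mulrA; lra.
  by rewrite addr_ge0 ?gauss_cdf_ge0// subr_ge0 gauss_cdf_le1.
(* Above the threshold, the argument of [gauss_cdf] in [g1] is at most [- M]. *)
have lo k : g1 k + - gauss_cdf (- M) <= f k.
  rewrite /f indicE; case: (boolP (k \in _)) => [_|].
    have g1le : g1 k <= 1 by exact: gauss_cdf_le1.
    by have := gauss_cdf_ge0 (- M); rewrite /=; lra.
  rewrite notin_setE /= => /negP; rewrite -ltNge ltr_pdivlMr// => kx.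
  rewrite subr_le0; apply: gauss_cdf_nondecreasing.
  by rewrite ler_pdivrMr ?mulr_gt0// mulrA; lra.
have := derangement_avg_le p01 n.-1 0 up; rewrite derangement_avg_addc.
have := derangement_avg_le p01 n.-1 0 lo; rewrite derangement_avg_addc.
have := gauss_cdf_le1 M; have := gauss_cdf_ge0 (- M).
by rewrite !ler_norml; lra.
Qed.

End NormalApproximation.

(** * Distribution function and tails of a standard normal variable *)

Section StandardNormalVariable.
Context (R : realType) (d : measure_display) (T : measurableType d).
Context (P : probability T R) (Z : {RV P >-> R}).
Hypothesis HZ : standard_normal Z.

Lemma cdf_standard_normal (x : R) : cdf Z x = (gauss_cdf x)%:E.
Proof. by rewrite /cdf HZ// fineK// fin_num_measure. Qed.

(** The limits of [gauss_cdf] at both infinities are those of the distribution function of [Z]. *)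
Lemma gauss_cdf_tails (e : R) : 0 < e ->
  exists2 M, 0 <= M & (1 - gauss_cdf M) + gauss_cdf (- M) <= e.
Proof.
move=> e0; have e2 : 0 < e / 2 by rewrite divr_gt0.
have cdfE : gauss_cdf = fine \o cdf Z.
  by apply/funext => y; rewrite /= cdf_standard_normal.
have hy : gauss_cdf M @[M --> +oo] --> (1 : R).
  by rewrite cdfE; exact/fine_cvg/cvg_cdfy1.
have hNy : gauss_cdf (- M) @[M --> +oo] --> (0 : R).
  apply/(cvgNy_compNP gauss_cdf).
  by rewrite cdfE; exact/fine_cvg/cvg_cdfNy0.
near (+oo : set_system R) => M; exists M.
  by near: M; exact: nbhs_pinfty_ge.
have : `|1 - gauss_cdf M| <= e / 2.
  by near: M; move/cvgrPdist_le : hy; exact.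
have : `|0 - gauss_cdf (- M)| <= e / 2.
  by near: M; move/cvgrPdist_le : hNy; exact.
by rewrite !ler_norml; lra.
Unshelve. all: by end_near. Qed.

End StandardNormalVariable.

(** * The law of the derangement process *)

Section DerangementLaw.
Context (R : realType) (d : measure_display) (T : measurableType d).
Context (P : probability T R).
Implicit Types (A B : set T) (x : nat -> R) (r : nat).

Let prob A : R := fine (P A).

Let prob_ge0 A : 0 <= prob A.
Proof. exact/fine_ge0/measure_ge0. Qed.

Let prob_setU A B : measurable A -> measurable B -> A `&` B = set0 ->
  prob (A `|` B) = prob A + prob B.
Proof.
move=> mA mB AB.
by rewrite /prob measureU// fineD// fin_num_measure.
Qed.

Let prob_le A B : measurable A -> measurable B -> A `<=` B -> prob A <= prob B.
Proof.
by move=> mA mB AB; rewrite fine_le ?fin_num_measure// le_measure ?inE.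
Qed.

(** The complement of [A] is null, and it covers [B] together with the intersection. *)
Lemma probability1_setI A B : measurable A -> measurable B ->
  P A = 1%E -> P (A `&` B) = P B.
Proof.
move=> mA mB PA.
have mAB := measurableI _ _ mA mB; have mC := measurableC mA.
apply/eqP; rewrite eq_le; apply/andP; split.
  by rewrite le_measure ?inE//; exact: subIsetr.
have : (P (~` A) = 0)%E by rewrite probability_setC// PA subee.
move=> PCA; rewrite -[leRHS]adde0 -PCA.
apply: le_trans (measureU2 P mAB mC).
rewrite le_measure ?inE//; first exact: measurableU.
by move=> w Bw; have [Aw|nAw] := pselect (A w); [left|right].
Qed.

Variables (p : nat -> R) (n : nat) (X : nat -> {RV P >-> R}).
Hypothesis HX : derangement_process p n X.

Let measurable_at r (a : R) : measurable (at_value X r a).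
Proof.
rewrite [at_value _ _ _](_ : _ = X r @^-1` [set a]); last by [].
exact: measurable_funPTI.
Qed.

Let past_step r x : (r <= n.+1)%N ->
  past X n r x = at_value X r (x r) `&` past X n r.+1 x.
Proof.
move=> rn; apply/seteqP; split => w /=.
  move=> H; split => [|i /andP[ri iN]]; first by apply: H; rewrite leqnn.
  by apply: H; rewrite (ltnW ri).
move=> [H1 H2] i /andP[]; rewrite leq_eqVlt => /orP[/eqP <- //|ri iN].
by apply: H2; rewrite ri.
Qed.

Let measurable_past r x : measurable (past X n r x).
Proof.
rewrite [past _ _ _ _](_ : _ =
  \bigcap_(i in [set i | (r <= i <= n.+1)%N]) at_value X i (x i))//.
exact: bigcap_measurableType.
Qed.

Let upd x r a : nat -> R := fun i => if i == r then a else x i.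

Let past_upd r x a : past X n r.+1 (upd x r a) = past X n r.+1 x.
Proof.
by apply/seteqP; split => w /= H i /[dup] iN /H ->; rewrite /upd;
  case: eqP => // E; move: iN; rewrite E ltnn.
Qed.

Let prob_split r B : (1 <= r <= n.+1)%N -> measurable B ->
  prob B = prob (at_value X r 0 `&` B) + prob (at_value X r 1 `&` B).
Proof.
move=> rn mB; rewrite -prob_setU; [|exact: measurableI|exact: measurableI|].
  rewrite -setIUl; congr prob; apply/seteqP; split => w /=; last by case.
  by move=> Bw; split => //; exact: (dp_values HX).
rewrite -subset0 => w /= [[h0 _] [h1 _]].
by move: h1; rewrite /at_value/= h0 => /esym/eqP; rewrite oner_eq0.
Qed.

(** The product form of the Markov property survives a null past, where both sides vanish. *)
Let markov_step r x (a : R) : (1 <= r <= n)%N ->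
  (0 < P (at_value X r.+1 (x r.+1)))%E ->
  prob (at_value X r a `&` past X n r.+1 x) =
  cond_prob P (at_value X r a) (at_value X r.+1 (x r.+1))
    * prob (past X n r.+1 x).
Proof.
move=> rn at0; have mB := measurable_past r.+1 x.
have mA := measurable_at r a.
have [B0|B0] := eqVneq (P (past X n r.+1 x)) 0%E.
  have -> : prob (past X n r.+1 x) = 0 by rewrite /prob B0.
  rewrite mulr0; apply/eqP; rewrite eq_le prob_ge0 andbT.
  have <- : prob (past X n r.+1 x) = 0 by rewrite /prob B0.
  by apply: prob_le; [exact: measurableI|exact: mB|exact: subIsetr].
have Bgt0 : (0 < P (past X n r.+1 x))%E by rewrite lt0e B0 measure_ge0.
have markov := dp_markov HX; rewrite -(markov r x a rn Bgt0) /cond_prob.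
rewrite -/(prob _) -/(prob _) divfK//.
by rewrite /prob fine_eq0// fin_num_measure.
Qed.

Hypotheses (n2 : (2 <= n)%N) (p1 : p 1%N = 0) (p2 : p 2%N = 1).

Variables (Q : set R).
Let g s : R := \1_Q s.
Let event : set T := [set w | Q (\sum_(1 <= i < n.+1) X i w)].
Hypothesis mevent : measurable event.

(* The conditional expectation of [g (s + X_r + ... + X_1)] given
   [X_(r+1) = a]. *)
Let cond_avg r (a s : R) : R :=
  if (a == 0) || (r == 1%N) then derangement_avg p g r s
  else derangement_avg p g r.-1 s.

(** Induction on the remaining time: the event is split by the value of the chain at [r], and the
    transition laws reproduce the recursion of [derangement_avg]. The product form avoids
    conditioning on null pasts. *)
Let prob_past_event r x : (r < n)%N -> x r.+1 = 0 \/ x r.+1 = 1 ->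
  prob (past X n r.+1 x `&` event) =
  prob (past X n r.+1 x) * cond_avg r (x r.+1) (\sum_(r.+1 <= i < n.+1) x i).
Proof.
elim: r x => [|r IH] x rn x01.
  have -> : cond_avg 0 (x 1%N) (\sum_(1 <= i < n.+1) x i) =
            g (\sum_(1 <= i < n.+1) x i) by rewrite /cond_avg; case: ifP.
  have sumE w : past X n 1 x w ->
      \sum_(1 <= i < n.+1) X i w = \sum_(1 <= i < n.+1) x i.
    move=> pw; apply: eq_big_nat => i /andP[i1 iN]; apply: pw.
    by rewrite i1 ltnW.
  rewrite /g indicE; have [Qx|nQx] := boolP (_ \in Q).
    rewrite mulr1; congr prob; apply/setIidPl => w pw.
    by rewrite /event/= sumE//; move: Qx; rewrite inE.
  rewrite mulr0 [X in prob X](_ : _ = set0) ?/prob ?measure0//.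
  rewrite -subset0 => w [pw]; rewrite /event/= sumE// => Qx.
  by move: nQx; rewrite notin_setE.
set B := past X n r.+2 x; set S := \sum_(_ <= i < _) _.
have mB : measurable B by exact: measurable_past.
have r1n : (1 <= r.+1 <= n)%N by lia.
have r1n' : (1 <= r.+1 <= n.+1)%N by lia.
(* The induction hypothesis is applied to the trajectory prolonged by the value [a], which also
   enters the running sum. *)
have branch a : a = 0 \/ a = 1 -> prob (at_value X r.+1 a `&` (B `&` event)) =
    prob (at_value X r.+1 a `&` B) * cond_avg r a (S + a).
  move=> a01; have := IH (upd x r.+1 a) (ltnW rn).
  rewrite past_step ?past_upd ?(leqW (ltnW rn))//.
  have -> : upd x r.+1 a r.+1 = a by rewrite /upd eqxx.
  move=> /(_ a01); rewrite -/B setIA => ->; congr (_ * cond_avg _ _ _).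
  rewrite big_ltn ?ltnS ?(ltnW rn)// /upd eqxx addrC; congr (_ + _).
  apply: eq_big_nat => i /andP[ri _]; case: eqP => // E.
  by move: ri; rewrite E ltnn.
rewrite (prob_split r1n'); last exact: measurableI.
rewrite (branch 0); last by left.
rewrite (branch 1); last by right.
have BE := prob_split r1n' mB; rewrite addr0.
have -> : cond_avg r 0 S = derangement_avg p g r S.
  by rewrite /cond_avg eqxx.
(* Time 1 has no transition law: [X 1 = 1] almost surely, which agrees with the recursion because
   [p 1 = 0]. *)
case: r => [|r] in IH rn B S mB r1n r1n' branch BE x01 *.
  have A1 : prob (at_value X 1 1 `&` B) = prob B.
    by rewrite /prob probability1_setI ?(dp_X1 HX).
  have A0 : prob (at_value X 1 0 `&` B) = 0.
    by move: BE; rewrite A1 => /eqP; rewrite -subr_eq subrr => /eqP.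
  rewrite A0 A1 mul0r add0r; congr (_ * _).
  by rewrite /cond_avg orbT /= if_same p1 mul0r add0r subr0 mul1r.
have rn2 : (2 <= r.+2 <= n.-1)%N by lia.
(* If the past is null, every term is zero; otherwise the last known value has positive probability
   and the transition laws apply. *)
have [B0|B0] := eqVneq (prob B) 0.
  have z a : prob (at_value X r.+2 a `&` B) = 0.
    apply/eqP; rewrite eq_le prob_ge0 andbT -[leRHS]B0.
    by apply: prob_le; [exact: measurableI|exact: mB|exact: subIsetr].
  by rewrite !z B0 !mul0r addr0.
have at_gt0 : (0 < P (at_value X r.+3 (x r.+3)))%E.
  have PB : (0 < P B)%E.
    by rewrite lt0e measure_ge0 andbT; apply: contra_neq B0; rewrite /prob => ->.
  apply: (lt_le_trans PB); rewrite le_measure ?inE//.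
  by move=> w; apply; rewrite leqnn ltnS ltnW.
have step := markov_step 0 r1n at_gt0; rewrite -/B in step.
have B1 : prob (at_value X r.+2 1 `&` B) =
    prob B - prob (at_value X r.+2 0 `&` B) by rewrite BE addrC addKr.
case: x01 => xr; rewrite B1 step xr; rewrite xr in at_gt0.
  have -> : cond_avg r.+2 0 S = p r.+2 * derangement_avg p g r.+1 S
      + (1 - p r.+2) * derangement_avg p g r (S + 1).
    by rewrite /cond_avg eqxx.
  (* At [r = 0] the two averages need not agree, but their weight [1 - p 2] vanishes. *)
  have -> : (1 - p r.+2) * derangement_avg p g r (S + 1) =
      (1 - p r.+2) * cond_avg r.+1 1 (S + 1).
    case: (r) => [|r']; first by rewrite p2 subrr !mul0r.
    by rewrite /cond_avg oner_eq0.
  by rewrite (dp_step00 HX)//; ring.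
rewrite (dp_step10 HX)// mul1r subrr mul0r addr0; congr (_ * _).
by rewrite /cond_avg oner_eq0.
Qed.

(** The values at [n.+1] and [n] are almost surely 1 and 0, so the formula for a known past applies
    with a past of probability one and running sum 0. *)
Lemma derangement_process_event : P event = (derangement_avg p g n.-1 0)%:E.
Proof.
have -> : P event = (prob event)%:E by rewrite fineK// fin_num_measure.
congr EFin.
pose x i : R := if i == n then 0 else 1.
have Pn : P (past X n n x) = 1%E.
  rewrite past_step// probability1_setI//; last by rewrite /x eqxx (dp_Xn HX).
  rewrite past_step// setIC probability1_setI//.
    by rewrite /x gtn_eqF// (dp_start HX).
  rewrite [past _ _ _ _](_ : _ = setT) ?probability_setT//.
  by apply/seteqP; split => // w _ i /andP[ni iN]; have := leq_trans ni iN;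
    rewrite ltnn.
have xn : x n = 0 by rewrite /x eqxx.
have n0 : n.-1.+1 = n by rewrite prednK// ltnW.
have := @prob_past_event n.-1 x; rewrite n0 => /(_ (leqnn n) (or_introl xn)).
rewrite xn big_nat1 xn /cond_avg eqxx /= /prob probability1_setI// => ->.
by rewrite Pn mul1r.
Qed.

End DerangementLaw.

(** * Convergence in distribution of the number of cycles *)

Lemma num_cyclesE (R : realType) (d : measure_display) (T : measurableType d)
  (P : probability T R) (X : nat -> {RV P >-> R}) n w :
  num_cycles X n w = \sum_(1 <= i < n.+1) X i w.
Proof.
rewrite /num_cycles.
by elim/big_rec2: _ => //= i y1 y2 _ <-.
Qed.

Theorem theorem8 (R : realType) (p : nat -> R)
  (p1 : p 1%N = 0) (p2 : p 2%N = 1)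
  (p01 : forall i : nat, (3 <= i)%N -> 0 < p i /\ p i < 1)
  (d : nat -> measure_display) (T : forall n : nat, measurableType (d n))
  (P : forall n : nat, probability (T n) R)
  (X : forall n : nat, nat -> {RV (P n) >-> R})
  (HX : forall n : nat, (2 <= n)%N -> derangement_process p n (X n))
  (Hq : sum_q2 p n ^+ 2 / sum_q p n @[n --> \oo] --> (0 : R))
  (d' : measure_display) (T' : measurableType d') (P' : probability T' R)
  (N : {RV P' >-> R}) (HN : standard_normal N) :
  cvg_in_distribution
    (fun n : nat => standardized (num_cycles (X n) n)
                       (sum_q p n) (Num.sqrt (sum_q p n)))
    N.
Proof.
move=> x _; rewrite (cdf_standard_normal HN).
have p01' i : (0 < i)%N -> 0 <= p i <= 1.
  case: i => [//|[|[|i]]] _; rewrite ?p1 ?p2 ?lexx ?ler01//.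
  by have [/ltW -> /ltW ->] := @p01 i.+3 isT.
pose F n := derangement_avg p (fun k =>
  \1_[set k | (k - sum_q p n) / Num.sqrt (sum_q p n) <= x] k) n.-1 0.
have cdfE n : (2 <= n)%N ->
    cdf (standardized (num_cycles (X n) n) (sum_q p n) (Num.sqrt (sum_q p n))) x
    = (F n)%:E.
  move=> n2.
  set K := standardized _ _ _.
  have KE : K @^-1` `]-oo, x] = [set w | [set k | (k - sum_q p n) /
      Num.sqrt (sum_q p n) <= x] (\sum_(1 <= i < n.+1) X n i w)].
    apply/seteqP; split => w /=; rewrite in_itv/= /K /standardized/= -num_cyclesE//.
  rewrite /cdf /distribution /pushforward KE.
  rewrite (derangement_process_event (HX n n2) n2 p1 p2)// -KE.
  exact: measurable_funPTI.
apply: cvg_EFin; first by near=> n; rewrite fin_num_measure.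
apply/cvgrPdist_le => eps eps0.
(* Three errors get [eps / 4] each: [M] settles the tails, then [e] the smoothing given [M] and [x],
   then [t] the remaining terms given [e]. *)
have e4 : 0 < eps / 4 by rewrite divr_gt0.
have [M M0 HM] := gauss_cdf_tails HN e4.
pose c := 17 * (2 * `|x| + 3 * M).
have c0 : 0 <= c by rewrite mulr_ge0// addr_ge0 ?mulr_ge0.
pose e := Num.min 2^-1 (eps / 4 / (c + 1)).
have e0 : 0 < e by rewrite lt_min invr_gt0 ltr0n/= divr_gt0//; lra.
have e12 : e <= 2^-1 by rewrite ge_min lexx.
have ce : c * e <= eps / 4.
  have : e <= eps / 4 / (c + 1) by rewrite ge_min lexx orbT.
  rewrite ler_pdivlMr; nra.
pose C := 34 / e + 102 / e ^+ 3.
have C0 : 0 < C by rewrite addr_gt0 ?divr_gt0// exprn_gt0.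
pose t := Num.min e (eps / 4 / C).
have t0 : 0 < t by rewrite lt_min e0/= divr_gt0.
have te : t <= e by rewrite ge_min lexx.
have Ct : C * t <= eps / 4.
  by rewrite mulrC -ler_pdivlMr// ge_min lexx orbT.
have t20 : 0 < t ^+ 2 by rewrite exprn_gt0.
(* At level [t^2], the square root of the assumption reads [sum_q2 p n <= t * sqrt (sum_q p n)]. *)
move/cvgrPdist_le : Hq => /(_ _ t20) Hq.
near=> n.
(* The term of index 1 is already 1, as [p 1 = 0]. *)
have V1 : 1 <= sum_q2 p n.
  have : (0 < n)%N by near: n; exists 1%N.
  case: (n) => // + _; elim=> [|m IH].
    by rewrite sum_q2S p1 /sum_q2 big_geq// subr0 expr1n add0r.
  by rewrite sum_q2S (le_trans IH)// lerDl sqr_ge0.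
have l0 : 0 < sum_q p n.
  by apply: lt_le_trans (sum_q2_le p01' n); lra.
have Vt : sum_q2 p n <= t * Num.sqrt (sum_q p n).
  have : `|0 - sum_q2 p n ^+ 2 / sum_q p n| <= t ^+ 2 by near: n.
  rewrite sub0r normrN ger0_norm; last by rewrite divr_ge0 ?sqr_ge0 ?ltW.
  rewrite ler_pdivrMr// => h.
  rewrite -(@ler_pXn2r _ 2)// ?nnegrE ?mulr_ge0 ?sqrtr_ge0 ?(ltW t0) ?(le_trans ler01)//.
  by rewrite exprMn sqr_sqrtr// ltW.
rewrite /= cdfE; last by near: n; exists 2%N.
have := @derangement_avg_cdf _ p p01' x M e t n M0.
rewrite e0 e12 t0 te V1 Vt => /(_ isT isT isT).
rewrite -/(F n) distrC => /le_trans; apply.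
rewrite mulrA -/c -/C; lra.
Unshelve. all: by end_near. Qed.
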